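(* Let $\alpha\in(0,1)$ and $p\in[0,1]$, let $(X_t)_{t\in\mathbb{N}_0}$ be the Antlion Random Walk with parameters $\alpha$ and $p$ started at $X_0=0$, let $t\in\mathbb{N}$, and let $$T_+(t)=\left|\{s\in\{1,\dots,t\} : X_s\ge 0\}\right|$$ be its positive-side residence time. (i) If $0<\alpha\le 1/2$, then $T_+(t)$ follows the binomial distribution $B(t,1-p)$. (ii) If $1/2<\alpha<1$ and $t$ satisfies $\alpha^t-2\alpha+1>0$, then $T_+(t)$ also follows the binomial distribution $B(t,1-p)$.
   Context: $\mathbb{N}=\{1,2,3,\dots\}$ and $\mathbb{N}_0=\mathbb{N}\cup\{0\}$. Let $(\xi_t)_{t\in\mathbb{N}}$ be independent, identically distributed random variables with $\mathbb{P}(\xi_t=-1)=p$ and $\mathbb{P}(\xi_t=1)=1-p$. The Antlion Random Walk (ARW) with parameters $\alpha$ and $p$ is the real-valued process defined by $X_0=0$ and $X_t=\alpha X_{t-1}+\xi_t$ for $t\in\mathbb{N}$; equivalently $X_t=\sum_{s=1}^{t}\alpha^{t-s}\xi_s$. $B(t,q)$ denotes the binomial distribution with $t$ trials and success probability $q$. *)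

(* Defs.v *)
From HB Require Import structures.
From mathcomp Require Import all_boot all_order all_algebra finmap.
From mathcomp Require Import all_classical all_reals all_analysis.
From mathcomp Require Import measurable_realfun.

Set Implicit Arguments.
Unset Strict Implicit.
Unset Printing Implicit Defensive.

Import Order.TTheory GRing.Theory Num.Theory.
Local Open Scope classical_set_scope.
Local Open Scope ring_scope.

(* The product rule is required for every finite subfamily of indices in D. *)
Definition mutually_independent {d d'} {T : measurableType d}
    {T' : measurableType d'} {R : realType} (P : probability T R)
    {I : choiceType} (D : set I) (X : I -> {RV P >-> T'}) : Prop :=
  forall (J : {fset I}) (A : I -> set T'),
    [set` J] `<=` D -> (forall i, i \in J -> measurable (A i)) ->
    P (\bigcap_(i in [set` J]) (X i @^-1` A i)) =
      (\prod_(i <- J) P (X i @^-1` A i))%E.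

Definition identically_distributed {d d'} {T : measurableType d}
    {T' : measurableType d'} {R : realType} (P : probability T R)
    {I : choiceType} (D : set I) (X : I -> {RV P >-> T'}) : Prop :=
  forall i j (A : set T'), D i -> D j -> measurable A ->
    distribution P (X i) A = distribution P (X j) A.

(* The steps are xi 1, xi 2, ...; the value xi 0 is never used. *)
Fixpoint antlion_walk {d} {T : measurableType d} {R : realType} (alpha : R)
    (xi : nat -> {mfun T >-> R}) (t : nat) : T -> R :=
  if t is s.+1 then
    fun w => alpha * antlion_walk alpha xi s w + xi s.+1 w
  else fun=> 0.

Definition positive_residence_time {d} {T : measurableType d} {R : realType}
    (alpha : R) (xi : nat -> {mfun T >-> R}) (t : nat) : T -> nat :=
  fun w => #|[set s : 'I_t.+1 | (1 <= s)%N && (0 <= antlion_walk alpha xi s w)]%SET|.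

Section measurability.
Context {d} {T : measurableType d} {R : realType}.
Variables (alpha : R) (xi : nat -> {mfun T >-> R}).

Lemma measurable_antlion_walk t :
  measurable_fun [set: T] (antlion_walk alpha xi t).
Proof.
elim: t => [|t IH] /=; first exact: measurable_cst.
by apply: measurable_funD => //; apply: measurable_funM.
Qed.

Lemma measurable_positive_residence_time t :
  measurable_fun [set: T] (positive_residence_time alpha xi t).
Proof.
pose sgn w := [ffun s : 'I_t.+1 => 0 <= antlion_walk alpha xi s w].
pose card (f : {ffun 'I_t.+1 -> bool}) :=
  #|[set s : 'I_t.+1 | (1 <= s)%N && f s]%SET|.
have cardE w : positive_residence_time alpha xi t w = card (sgn w).
  by apply: eq_card => s; rewrite !inE ffunE.
move=> _ Y _; rewrite setTI.
rewrite (_ : _ @^-1` Y =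
  \bigcup_(f in [set f | Y (card f)]) [set w | sgn w = f]); last first.
  apply/seteqP; split => [w /= | w [f /= Yf fw]].
    by rewrite cardE => Yw; exists (sgn w).
  by rewrite /= cardE fw.
apply: fin_bigcup_measurable => [|f _]; first exact: finite_finset.
rewrite (_ : [set w | sgn w = f] =
  \bigcap_(s in [set: 'I_t.+1])
    [set w | (0 <= antlion_walk alpha xi s w) = f s]); last first.
  apply/seteqP; split => w /= H; first by move=> s _ /=; rewrite -H ffunE.
  by apply/ffunP => s; rewrite ffunE; exact: H.
apply: fin_bigcap_measurable => [|s _]; first exact: finite_finset.
have mge : measurable_fun [set: T] (fun w => 0 <= antlion_walk alpha xi s w).
  by apply: measurable_fun_ler => //; exact: measurable_antlion_walk.
by have := mge measurableT [set f s] I; rewrite setTI.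
Qed.

HB.instance Definition _ t := isMeasurableFun.Build _ _ _ _
  (antlion_walk alpha xi t) (measurable_antlion_walk t).

HB.instance Definition _ t := isMeasurableFun.Build _ _ _ _
  (positive_residence_time alpha xi t) (measurable_positive_residence_time t).

End measurability.

(* Main.v *)
Require Import Defs.
From HB Require Import structures.
From mathcomp Require Import all_boot all_order all_algebra finmap.
From mathcomp Require Import all_classical all_reals all_analysis.
From mathcomp Require Import lra.

(** Multiplying [X_s = alpha X_(s-1) + xi_s] by [1 - alpha] shows that
    [(1 - alpha) |X_s| <= 1 - alpha ^ s] when the steps are [1] or [-1].  Both
    parts satisfy [alpha ^ t - 2 alpha + 1 > 0], which then forces
    [|alpha X_(s-1)| < 1] for [s <= t]: the last step decides the sign of [X_s],
    so [T_+(t)] counts the steps equal to [1].  The sign patterns of the first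
    [t] steps give disjoint events of product probability, so the law of
    [T_+(t)] dominates the binomial law on every set; two probability measures
    so ordered are equal, hence no separate treatment is needed for the null
    set on which some step is neither [1] nor [-1]. *)

Set Implicit Arguments.
Unset Strict Implicit.
Unset Printing Implicit Defensive.

Import Order.TTheory GRing.Theory Num.Theory.
Local Open Scope classical_set_scope.
Local Open Scope ring_scope.

(** This is the geometric-sum bound with its denominator cleared. The induction closes because
    [alpha * (1 - alpha ^+ t) + (1 - alpha) = 1 - alpha ^+ t.+1]. *)
Lemma normr_antlion_walk_le (d : measure_display) (T : measurableType d)
    (R : realType) (alpha : R) (xi : nat -> {mfun T >-> R}) (w : T) (t : nat) :
  0 <= alpha <= 1 -> (forall s, (1 <= s <= t)%N -> `|xi s w| <= 1) ->
  (1 - alpha) * `|antlion_walk alpha xi t w| <= 1 - alpha ^+ t.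
Proof.
move=> /andP[a0 a1]; elim: t => [|t IH] xi1 /=.
  by rewrite normr0 mulr0 expr0 subrr.
have {}IH : (1 - alpha) * `|antlion_walk alpha xi t w| <= 1 - alpha ^+ t.
  by apply: IH => s /andP[s1 st]; apply: xi1; rewrite s1 ltnW.
have xit : `|xi t.+1 w| <= 1 by apply: xi1; rewrite ltnSn.
have a1' : 0 <= 1 - alpha by rewrite subr_ge0.
apply: (@le_trans _ _ ((1 - alpha) *
    (alpha * `|antlion_walk alpha xi t w| + 1))).
  apply: ler_wpM2l => //; apply: (le_trans (ler_normD _ _)).
  by rewrite normrM (ger0_norm a0) lerD2l.
rewrite mulrDr mulrCA exprS mulr1.
have := ler_wpM2l a0 IH; lra.
Qed.

Lemma antlion_walk_ge0E (d : measure_display) (T : measurableType d)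
    (R : realType) (alpha : R) (xi : nat -> {mfun T >-> R}) (w : T)
    (s t : nat) :
  0 < alpha < 1 -> 0 < alpha ^+ t - 2 * alpha + 1 ->
  (forall r, (1 <= r <= t)%N -> xi r w = 1 \/ xi r w = -1) ->
  (1 <= s <= t)%N ->
  (0 <= antlion_walk alpha xi s w) = (xi s w == 1).
Proof.
move=> /andP[a0 a1] at0 xi1; case: s => [//|s] /= st.
have bnd : (1 - alpha) * `|antlion_walk alpha xi s w| <= 1 - alpha ^+ s.
  apply: normr_antlion_walk_le; first by rewrite !ltW.
  move=> r /andP[r1 rs].
  have /xi1[->|->] : (1 <= r <= t)%N.
  - by rewrite r1 (leq_trans rs) // ltnW.
  - by rewrite normr1.
  - by rewrite normrN1.
(* Powers of [alpha] decrease, so the condition at [t] carries over to the exponent [s.+1]; there it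
   reads [alpha - alpha ^+ s.+1 < 1 - alpha], which is what the bound needs. *)
have ats : alpha ^+ t <= alpha ^+ s.+1.
  by apply: ler_wiXn2l; rewrite ?ltW.
have {bnd} : `|alpha * antlion_walk alpha xi s w| < 1.
  rewrite normrM (gtr0_norm a0) -(@ltr_pM2l _ (1 - alpha)) ?subr_gt0 //.
  rewrite mulrCA mulr1 (le_lt_trans (ler_wpM2l (ltW a0) bnd)) //.
  by rewrite mulrBr mulr1 -exprS; lra.
rewrite ltr_norml => /andP[lo hi].
case: (xi1 s.+1 st) => ->; first by rewrite eqxx; apply: ltW; lra.
have -> : (-1 == 1 :> R) = false by apply/eqP; lra.
by apply: negbTE; rewrite -ltNge; lra.
Qed.

(** Dropping the excluded time 0 shifts the index: the ordinal [i] now stands for time [i.+1], as in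
    the sign patterns below. *)
Lemma positive_residence_timeE (d : measure_display) (T : measurableType d)
    (R : realType) (alpha : R) (xi : nat -> {mfun T >-> R}) (t : nat) (w : T) :
  positive_residence_time alpha xi t w =
  #|[set i : 'I_t | 0 <= antlion_walk alpha xi i.+1 w]%SET|.
Proof.
rewrite /positive_residence_time -!sum1_card big_mkcond [RHS]big_mkcond /=.
rewrite big_ord_recl /= inE /= add0n.
by apply: eq_bigr => i _; rewrite !inE.
Qed.

(** Grouping the subsets by size [k] gives ['C(t, k)] equal terms. The sum over subsets matches the
    sum over sign patterns. *)
Lemma binomial_prob_sum_set (R : realType) (t : nat) (q : R) (U : set nat) :
  0 <= q <= 1 ->
  binomial_prob t q U =
  (\sum_(J : {set 'I_t} | #|J| \in U)
    (q ^+ #|J| * (1 - q) ^+ (t - #|J|))%:E)%E.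
Proof.
move=> /andP[q0 q1]; rewrite (@binomial_probE _ t q q0 q1).
have cardJ (J : {set 'I_t}) : (#|J| < t.+1)%N.
  by rewrite ltnS (leq_trans (max_card _)) // card_ord.
rewrite (partition_big (fun J : {set 'I_t} => Ordinal (cardJ J)) xpredT) //=.
apply: eq_bigr => k _; rewrite diracE.
have [kU|kU] := boolP (_ \in U); last first.
  rewrite mule0 big1 // => J /andP[+ /eqP/(congr1 val)/= Jk].
  by rewrite Jk (negbTE kU).
rewrite mule1 (eq_bigl (fun J : {set 'I_t} => J \in
    [set J : {set 'I_t} | #|J| == k]%SET)); last first.
  move=> J; rewrite inE -val_eqE /=.
  by case: eqP => [->|]; rewrite ?kU ?andbF.
rewrite (eq_bigr (fun=> (q ^+ k * (1 - q) ^+ (t - k))%:E)); last first.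
  by move=> J; rewrite inE => /eqP ->.
by rewrite sumEFin sumr_const card_draws card_ord.
Qed.

(** The inequality on the complement of [A] reads [1 - mu A <= 1 - nu A], which is the reverse
    inequality on [A]. *)
Lemma le_probability_eq (d : measure_display) (T : measurableType d)
    (R : realType) (mu nu : probability T R) :
  (forall A, measurable A -> (mu A <= nu A)%E) ->
  forall A, measurable A -> mu A = nu A.
Proof.
move=> munu A mA; apply/eqP; rewrite eq_le munu //=.
have := munu _ (measurableC mA); rewrite !probability_setC //.
rewrite -(fineK (fin_num_measure mu _ mA)) -(fineK (fin_num_measure nu _ mA)).
by rewrite -!EFinB !lee_fin lerD2l lerN2.
Qed.

Section step_signs.
Context (d : measure_display) (T : measurableType d) (R : realType).
Variables (P : probability T R) (xi : nat -> {RV P >-> R}) (t : nat).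

(** [J] records the positions of the steps equal to 1. An outcome with some other step value lies in
    none of these events. *)
Definition step_signs (J : {set 'I_t}) : set T :=
  [set w | forall i : 'I_t, xi i.+1 w = if i \in J then 1 else -1].

Lemma step_signs_setE (J : {set 'I_t}) (w : T) :
  step_signs J w -> [set i : 'I_t | xi i.+1 w == 1]%SET = J.
Proof.
move=> Jw; apply/setP => i; rewrite inE Jw; case: ifP => _; first exact: eqxx.
by apply/eqP; lra.
Qed.

(** This is the shape that [mutually_independent] accepts. [insub] turns a time [n] back into an
    ordinal; its default [setT] is never reached for [n] between 1 and [t]. *)
Lemma step_signs_bigcap (J : {set 'I_t}) :
  step_signs J = \bigcap_(n in [set` [fset n in iota 1 t]%fset])
    (xi n @^-1` oapp (fun i => [set if i \in J then 1 else -1]) setT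
      (insub n.-1)).
Proof.
apply/seteqP; split => w /= Jw.
  move=> n /=; rewrite inE mem_iota /= => /andP[].
  case: n => // n _; rewrite add1n ltnS => nt /=.
  by rewrite (insubT (fun m => (m < t)%N) nt) /=; exact: (Jw (Ordinal nt)).
move=> i; have /= := Jw i.+1; rewrite valK /=; apply.
by rewrite inE mem_iota /= add1n ltnS.
Qed.

Lemma measurable_step_signs (J : {set 'I_t}) : measurable (step_signs J).
Proof.
rewrite step_signs_bigcap; apply: fin_bigcap_measurable => // n _.
rewrite -[X in measurable X]setTI; apply: measurable_funPT => //.
by case: insub => [i|] //=.
Qed.

Lemma probability_step_signs (p : R) (J : {set 'I_t}) :
  mutually_independent [set s | (1 <= s)%N] xi ->
  (forall s, (1 <= s)%N -> P [set w | xi s w = -1] = p%:E) ->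
  (forall s, (1 <= s)%N -> P [set w | xi s w = 1] = (1 - p)%:E) ->
  P (step_signs J) = ((1 - p) ^+ #|J| * p ^+ (t - #|J|))%:E.
Proof.
move=> hind hm1 hp1; rewrite step_signs_bigcap hind; last 2 first.
- by move=> n /=; rewrite inE mem_iota => /andP[].
- by move=> n _; case: insub => [i|] //=.
rewrite (perm_big (index_iota 1 t.+1)); last first.
  apply: uniq_perm; [exact: fset_uniq|exact: iota_uniq|].
  by move=> n; rewrite !inE /index_iota subSS subn0.
rewrite big_add1 big_mkord /=.
rewrite (eq_bigr (fun i => (if i \in J then 1 - p else p)%:E)); last first.
  move=> i _; rewrite valK /=.
  by case: ifP => _; [exact: hp1|exact: hm1].
(* Splitting along [J] leaves [#|J|] factors [1 - p] and [t - #|J|] factors [p]. *)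
rewrite prodEFin (bigID (mem J)) /=; congr ((_ * _)%:E).
  rewrite (eq_bigr (fun=> 1 - p)) ?prodr_const // => i.
  by move=> ->.
rewrite (eq_bigr (fun=> p)); last by move=> i /negbTE ->.
rewrite prodr_const; congr (_ ^+ _).
by rewrite -[X in (X - _)%N](card_ord t) -(cardC (mem J)) addKn.
Qed.

Lemma trivIset_step_signs : trivIset setT step_signs.
Proof.
apply/trivIsetP => J K _ _ JK; rewrite -subset0 => w [Jw Kw].
by case/eqP: JK; rewrite -(step_signs_setE Jw) (step_signs_setE Kw).
Qed.

End step_signs.

Lemma distribution_positive_residence_time (d : measure_display)
    (T : measurableType d) (R : realType) (P : probability T R) (alpha p : R)
    (xi : nat -> {RV P >-> R}) (t : nat) :
  0 < alpha < 1 -> 0 <= p <= 1 ->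
  mutually_independent [set s | (1 <= s)%N] xi ->
  (forall s, (1 <= s)%N -> P [set w | xi s w = -1] = p%:E) ->
  (forall s, (1 <= s)%N -> P [set w | xi s w = 1] = (1 - p)%:E) ->
  0 < alpha ^+ t - 2 * alpha + 1 ->
  distribution P (positive_residence_time alpha xi t) =
    binomial_prob t (1 - p).
Proof.
move=> a01 /andP[p0 p1] hind hm1 hp1 at0.
have q01 : 0 <= 1 - p <= 1 by apply/andP; split; lra.
apply/esym/funext => U.
(* The binomial law goes on the smaller side, since the sign patterns only fill part of the event
   that the count lies in [U]. *)
apply: (@le_probability_eq _ _ _ (binomial_prob t (1 - p))
  (distribution P (positive_residence_time alpha xi t))) => // {}U _.
rewrite [leLHS]binomial_prob_sum_set // subKr.
rewrite (eq_bigr (fun J => P (step_signs xi J))); last first.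
  by move=> J _; rewrite (@probability_step_signs _ _ _ _ _ _ p).
have -> : (\sum_(J : {set 'I_t} | #|J| \in U) P (step_signs xi J))%E =
    P (\bigcup_(J in [set J : {set 'I_t} | #|J| \in U]) step_signs xi J).
  rewrite measure_fin_bigcup.
  - rewrite [LHS]bigfs //; first exact: index_enum_uniq.
    by move=> J _; rewrite mem_index_enum.
  - exact: finite_finset.
  - exact: sub_trivIset (@trivIset_step_signs _ _ _ _ xi t).
  - by move=> J _; exact: measurable_step_signs.
apply: le_measure; rewrite ?inE.
- apply: fin_bigcup_measurable => [|J _]; first exact: finite_finset.
  exact: measurable_step_signs.
- by rewrite -[X in measurable X]setTI; apply: measurable_funPT.
move=> w [J /= JU Jw]; rewrite positive_residence_timeE.
suff -> : [set i : 'I_t | 0 <= antlion_walk alpha xi i.+1 w]%SET = J.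
  exact: set_mem.
rewrite -[RHS](step_signs_setE Jw); apply/setP => i; rewrite !inE.
apply: (antlion_walk_ge0E a01 at0); last by rewrite ltn_ord.
move=> [//|r] /= rt; rewrite (Jw (Ordinal rt)).
by case: ifP => _; [left|right].
Qed.

Theorem proposition3p6 (d : measure_display) (T : measurableType d)
    (R : realType) (P : probability T R) (alpha p : R)
    (xi : nat -> {RV P >-> R}) (t : nat)
    (halpha : 0 < alpha < 1) (hp : 0 <= p <= 1)
    (hind : mutually_independent [set s | (1 <= s)%N] xi)
    (hid : identically_distributed [set s | (1 <= s)%N] xi)
    (hm1 : forall s, (1 <= s)%N -> P [set w | xi s w = -1] = p%:E)
    (hp1 : forall s, (1 <= s)%N -> P [set w | xi s w = 1] = (1 - p)%:E)
    (ht : (1 <= t)%N) :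
  (0 < alpha <= 1 / 2 ->
    distribution P (positive_residence_time alpha xi t) =
      binomial_prob t (1 - p)) /\
  (1 / 2 < alpha < 1 -> 0 < alpha ^+ t - 2 * alpha + 1 ->
    distribution P (positive_residence_time alpha xi t) =
      binomial_prob t (1 - p)).
Proof.
(* For [alpha <= 1 / 2] one has [1 - 2 * alpha >= 0], so positivity of the power alone gives the
   condition. *)
have at_gt0 : 0 < alpha ^+ t by case/andP: halpha => a0 _; exact: exprn_gt0.
split => [/andP[_ a2]|_ at0];
  apply: distribution_positive_residence_time => //; lra.
Qed.
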